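(* Let $\mathfrak{g}$ be a real nilpotent Lie algebra of dimension $n$ with center $\mathfrak{z}(\mathfrak{g})$, put $d=\dim\mathfrak{z}(\mathfrak{g})$, and let $Z_1,\dots,Z_n$ be a fixed strong Malcev basis of $\mathfrak{g}$ passing through the center. Let $\ell$ be a linear functional in $\mathfrak{g}^{\ast}$. A Vergne polarizing subalgebra subordinated to the linear functional $\ell$ is $$\mathfrak{p}(\ell)=\mathfrak{z}(\mathfrak{g})+\mathbb{R}Z_{d+1}+\sum_{\substack{1<s\le n-d\\ s\notin\mathbf{I}(\ell)}}\mathrm{nullspace}\bigl(M_0(\ell_{d+s})\bigr),$$ where $\mathbf{I}(\ell)=\{\,1<s\le n-d:\ \mathrm{rank}(M_0(\ell_{d+s}))=s\,\}$.
   Context: A strong Malcev basis passing through the center is a basis $Z_1,\dots,Z_n$ of $\mathfrak{g}$ such that $\mathfrak{g}_j=\mathbb{R}\text{-span}\{Z_1,\dots,Z_j\}$ is an ideal of $\mathfrak{g}$ for every $1\le j\le n$ and $\mathfrak{g}_d=\mathfrak{z}(\mathfrak{g})$, where $d=\dim\mathfrak{z}(\mathfrak{g})$. For $\ell\in\mathfrak{g}^*$, $\ell_j=\ell|_{\mathfrak{g}_j}$ denotes the restriction, $B_{\ell_j}(X,Y)=\ell_j([X,Y])$ for $X,Y\in\mathfrak{g}_j$, and $\mathfrak{r}(\ell_j)=\{Y\in\mathfrak{g}_j: B_{\ell_j}(X,Y)=0\text{ for all }X\in\mathfrak{g}_j\}$ is its radical. The Vergne polarizing subalgebra subordinated to $\ell$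 (relative to the fixed basis) is $\mathfrak{p}(\ell)=\sum_{j=1}^n\mathfrak{r}(\ell_j)$. For $1<s\le n-d$, $M_0(\ell_{d+s})$ is the $s\times s$ real skew-symmetric matrix with $(a,b)$ entry $\ell([Z_{d+a},Z_{d+b}])$, $1\le a,b\le s$. Its nullspace is regarded as a subspace of $\mathfrak{g}$ by identifying a column vector $(x_1,\dots,x_s)^t\in\mathbb{R}^s$ with $x_1Z_{d+1}+\cdots+x_sZ_{d+s}$. *)

(* Defs.v *)
From HB Require Import structures.
From mathcomp Require Import all_boot all_order all_algebra.
From mathcomp Require Import reals.

Set Implicit Arguments.
Unset Strict Implicit.
Unset Printing Implicit Defensive.

Import GRing.Theory.
Local Open Scope ring_scope.

Reserved Notation "{[ x , y ]}" (at level 0, x, y at level 99,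
  format "{[ x ,  y ]}").

HB.mixin Record isLieAlgebra (R : fieldType) g of Vector R g := {
  lie_bracket : g -> g -> g;
  lie_linearl : forall (a : R) (x y z : g),
    lie_bracket (a *: x + y) z = a *: lie_bracket x z + lie_bracket y z;
  lie_linearr : forall (a : R) (x y z : g),
    lie_bracket x (a *: y + z) = a *: lie_bracket x y + lie_bracket x z;
  lie_alternating : forall x : g, lie_bracket x x = 0;
  lie_jacobi : forall x y z : g,
    lie_bracket x (lie_bracket y z) + lie_bracket y (lie_bracket z x)
    + lie_bracket z (lie_bracket x y) = 0
}.

#[short(type="lieAlgType")]
HB.structure Definition LieAlgebra (R : fieldType) :=
  {g of isLieAlgebra R g & Vector R g}.

Notation "{[ x , y ]}" := (lie_bracket x y) : ring_scope.

Section LieAlgebraTheory.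
Variables (R : fieldType) (g : lieAlgType R).
Implicit Types (x y z : g) (U V : {vspace g}) (l : 'Hom(g, R^o)).

HB.instance Definition _ x :=
  GRing.isLinear.Build R g g _ (lie_bracket x)
    (fun a y z => lie_linearr a x y z).

Lemma lie_skew x y : {[x, y]} = - {[y, x]}.
Proof.
have Dl a b c : {[a + b, c]} = {[a, c]} + {[b, c]}.
  by have := lie_linearl 1 a b c; rewrite !scale1r.
apply/eqP; rewrite -addr_eq0; apply/eqP.
have := lie_alternating (x + y).
by rewrite Dl !raddfD /= !lie_alternating addr0 add0r.
Qed.

Definition lie_center : {vspace g} :=
  (\bigcap_(X <- vbasis fullv) lker (linfun (lie_bracket X)))%VS.

Definition lie_product U V : {vspace g} :=
  <<[seq {[X, Y]} | X <- vbasis U, Y <- vbasis V]>>%VS.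

(* Indexed from 0: term 0 is g itself, term k.+1 is [g, term k]. *)
Definition lower_central_series (k : nat) : {vspace g} :=
  iter k (lie_product fullv) fullv.

Definition lie_nilpotent : Prop :=
  exists k : nat, lower_central_series k = 0%VS.

Definition lie_ideal U : Prop := forall X Y, Y \in U -> {[X, Y]} \in U.

(* The radical r(l|_U) of the form (X, Y) |-> l [X, Y] on U. *)
Definition radical l U : {vspace g} :=
  (U :&: \bigcap_(X <- vbasis U) lker (l \o linfun (lie_bracket X)))%VS.

Lemma mem_bigcapv (s : seq g) (F : g -> {vspace g}) Y :
  (Y \in \bigcap_(X <- s) F X)%VS = all (fun X => Y \in F X) s.
Proof.
elim: s => [|X s IHs] /=; first by rewrite big_nil memvf.
by rewrite big_cons memv_cap IHs.
Qed.

Lemma bigcap_lker_vbasisP (aT : vectType R) (f : g -> 'Hom(g, aT)) U Y :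
    linear (fun X => f X Y) ->
  reflect (forall X, X \in U -> f X Y = 0)
          (Y \in \bigcap_(X <- vbasis U) lker (f X))%VS.
Proof.
move=> lin; pose hM := GRing.isLinear.Build R g aT _ (fun X => f X Y) lin.
pose h : {linear g -> aT} := HB.pack (fun X => f X Y) hM.
rewrite mem_bigcapv; apply: (iffP allP) => H X XU; last first.
  by rewrite memv_ker (H _ (vbasis_mem XU)).
rewrite -[f X Y]/(h X) (coord_vbasis XU) linear_sum big1 // => i _.
have /H : (vbasis U)`_i \in (vbasis U : seq g) by rewrite mem_nth ?size_tuple.
by rewrite linearZ /= memv_ker => /eqP->; rewrite scaler0.
Qed.

Lemma lie_centerP Y :
  reflect (forall X, {[X, Y]} = 0) (Y \in lie_center).
Proof.
have lin : linear (fun X => linfun (lie_bracket X) Y).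
  by move=> a X X'; rewrite !lfunE /= lie_linearl.
apply: (iffP (bigcap_lker_vbasisP fullv lin)) => [H X|H X _].
- by have := H X (memvf X); rewrite lfunE.
- by rewrite lfunE /= H.
Qed.

Lemma radicalP l U Y :
  reflect (Y \in U /\ forall X, X \in U -> l {[X, Y]} = 0) (Y \in radical l U).
Proof.
have lin : linear (fun X => (l \o linfun (lie_bracket X))%VF Y).
  by move=> a X X'; rewrite !comp_lfunE !lfunE /= lie_linearl linearP.
rewrite /radical memv_cap.
apply: (iffP andP) => -[YU H]; split=> //.
  move=> X XU; have /(bigcap_lker_vbasisP U lin)/(_ X XU) := H.
  by rewrite comp_lfunE lfunE.
apply/(bigcap_lker_vbasisP U lin) => X XU.
by rewrite comp_lfunE lfunE /= H.
Qed.

Section MalcevBasis.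
Variables (n : nat) (Z : n.-tuple g).

(* The tuple is indexed from 0: Z`_i stands for Z_(i+1), and Z`_i = 0 when
   n <= i. Below, d is meant to be the dimension of the center. *)
Definition malcev_span (j : nat) : {vspace g} := <<take j Z>>%VS.

Definition strong_malcev_basis_through_center : Prop :=
  [/\ basis_of fullv Z,
      forall j, (1 <= j <= n)%N -> lie_ideal (malcev_span j)
    & malcev_span (\dim lie_center) = lie_center].

Definition vergne_polarization l : {vspace g} :=
  (\sum_(1 <= j < n.+1) radical l (malcev_span j))%VS.

(* M_0(l_(d+s)): both indices of l [Z_(d+a), Z_(d+b)] run from 1 to s in the
   1-based numbering, hence Z`_(d + a) with a < s here. *)
Definition M0 l (d s : nat) : 'M[R]_s :=
  \matrix_(a < s, b < s) l {[Z`_(d + a), Z`_(d + b)]}.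

Definition Iset l (d : nat) : pred nat :=
  [pred s | (1 < s <= n - d)%N && (\rank (M0 l d s) == s)].

(* The identification of (x_1, .., x_s)^t with
   x_1 Z_(d+1) + .. + x_s Z_(d+s). *)
Definition embed_col (d s : nat) (x : 'cV[R]_s) : g :=
  \sum_(a < s) x a 0 *: Z`_(d + a).

Lemma embed_col_is_linear d s : linear (@embed_col d s).
Proof.
move=> c x y; rewrite /embed_col scaler_sumr -big_split /=.
by apply: eq_bigr => a _; rewrite !mxE scalerDl scalerA.
Qed.

HB.instance Definition _ d s :=
  GRing.isLinear.Build R 'cV[R]_s g _ (@embed_col d s)
    (@embed_col_is_linear d s).

Definition nullspace (s : nat) (M : 'M[R]_s) : {vspace 'cV[R]_s} :=
  lker (linfun (mulmx M : 'cV[R]_s -> 'cV[R]_s)).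

Definition nullspace_in (d s : nat) (M : 'M[R]_s) : {vspace g} :=
  (linfun (@embed_col d s) @: nullspace M)%VS.

Lemma nullspace_inP d s (M : 'M[R]_s) (Y : g) :
  reflect (exists2 x : 'cV[R]_s, M *m x = 0 & Y = embed_col d x)
          (Y \in nullspace_in d M).
Proof.
apply: (iffP memv_imgP) => [[x]|[x Mx ->]].
  by rewrite memv_ker lfunE => /eqP Mx ->; exists x; rewrite ?lfunE.
by exists x; rewrite ?memv_ker lfunE //= Mx.
Qed.

End MalcevBasis.
End LieAlgebraTheory.

(* Main.v *)
(* Modulo the center, the form (X, Y) |-> l [X, Y] on span (Z_1, .., Z_(d+s))
   has matrix M_0(l_(d+s)), so its radical is the center plus the nullspace of
   that matrix. For s = 1 the matrix is zero, for s in I(l) the nullspace is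
   trivial, and for j <= d the radical of l_j lies in the center. *)
Require Import Defs.
From mathcomp Require Import all_boot all_order all_algebra.
From mathcomp Require Import reals.

Set Implicit Arguments.
Unset Strict Implicit.
Unset Printing Implicit Defensive.

Import GRing.Theory.
Local Open Scope ring_scope.

Section Radical.
Variables (F : fieldType) (g : lieAlgType F) (n : nat) (Z : n.-tuple g).
Implicit Types (d s i j : nat) (l : 'Hom(g, F^o)).

Lemma nth_malcev_span i j : (i < j)%N -> Z`_i \in malcev_span Z j.
Proof.
move=> ij; have [iZ|Zi] := ltnP i (size Z); last by rewrite nth_default ?mem0v.
by rewrite memv_span // -(nth_take _ ij) mem_nth // size_take_min leq_min ij.
Qed.

Lemma malcev_spanS i j : (i <= j)%N -> (malcev_span Z i <= malcev_span Z j)%VS.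
Proof.
move=> ij; apply/span_subvP => v /(nthP 0)[k].
rewrite size_take_min leq_min => /andP[ki _] <-.
by rewrite nth_take // nth_malcev_span // (leq_trans ki).
Qed.

Lemma embed_col_delta d s (a : 'I_s) :
  embed_col Z d (delta_mx a 0) = Z`_(d + a).
Proof.
rewrite /embed_col (bigD1 a) //= big1 ?addr0; last first.
  by move=> b ba; rewrite mxE (negPf ba) scale0r.
by rewrite mxE !eqxx scale1r.
Qed.

Lemma embed_col_malcev_span d s (x : 'cV[F]_s) :
  embed_col Z d x \in malcev_span Z (d + s).
Proof.
by apply: memv_suml => a _; rewrite memvZ // nth_malcev_span // ltn_add2l.
Qed.

(** This splitting writes a vector of g_(d+s) as a vector of g_d plus [embed_col] of a column, which
    is how matrices enter the computation of the radical. *)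
Lemma malcev_spanD d s :
  malcev_span Z (d + s) =
    (malcev_span Z d + limg (linfun (@embed_col _ _ _ Z d s)))%VS.
Proof.
apply/eqP; rewrite eqEsubv subv_add malcev_spanS ?leq_addr //=.
apply/andP; split; last first.
  by apply/subvP => _ /memv_imgP[x _ ->]; rewrite lfunE embed_col_malcev_span.
rewrite /malcev_span takeD span_cat addvS //; apply/span_subvP => v /(nthP 0)[a].
rewrite size_take_min leq_min => /andP[ls _] <-; rewrite nth_take // nth_drop.
(* The bound [ls] turns [a] into an ordinal, so that Z_(d+a+1) becomes the image of a standard basis
   column. *)
rewrite -[a]/(nat_of_ord (Ordinal ls)) -embed_col_delta -(lfunE (@embed_col _ _ _ Z d s)).
by rewrite memv_img ?memvf.
Qed.

Lemma M0_mulmxE l d s (x : 'cV[F]_s) (a : 'I_s) :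
  (M0 Z l d s *m x) a 0 = l {[Z`_(d + a), embed_col Z d x]}.
Proof.
rewrite mxE /embed_col !linear_sum; apply: eq_bigr => b _.
by rewrite mxE !linearZ /= mulrC.
Qed.

Lemma radical_malcev_span l d s : malcev_span Z d = lie_center g ->
  radical l (malcev_span Z (d + s)) =
    (lie_center g + nullspace_in Z d (M0 Z l d s))%VS.
Proof.
move=> spand; apply/vspaceP => Y; apply/radicalP/memv_addP => [[YU lY]|].
- move: YU lY; rewrite {1}malcev_spanD spand.
  move=> /memv_addP[c cC [_ /memv_imgP[x _ ->] ->]] lY.
  exists c => //; exists (embed_col Z d x); last by rewrite lfunE.
  apply/nullspace_inP; exists x => //.
  apply/matrixP => a j; rewrite ord1 M0_mulmxE mxE.
  (* Testing the radical condition against this one basis vector gives row [a] of the equation M_0 x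
     = 0, since the central part [c] brackets to zero. *)
  have Za : Z`_(d + a) \in malcev_span Z (d + s).
    by rewrite nth_malcev_span // ltn_add2l.
  by rewrite -{}(lY _ Za) lfunE linearD /= (lie_centerP _ cC) add0r.
- case=> c cC [_ /nullspace_inP[x Mx0 ->] ->]; split.
    rewrite memvD ?embed_col_malcev_span //.
    by rewrite (subvP (malcev_spanS (leq_addr s d))) // spand.
  move=> X; rewrite malcev_spanD spand.
  move=> /memv_addP[c' c'C [_ /memv_imgP[y _ ->] ->]].
  rewrite lfunE /= linearD /= (lie_centerP _ cC) add0r.
  (* Skew-symmetry brings the central [c'] and the sum for [y] into the second slot, to be killed or
     expanded there. A second swap on each term cancels the sign and exposes an entry of M_0 x,
     which is zero. *)
  rewrite lie_skew linearD /= [{[_, c']}](lie_centerP _ c'C) add0r.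
  rewrite [X in {[_, X]}]/embed_col linear_sum -sumrN linear_sum big1 // => a _.
  rewrite linearZ /= lie_skew scalerN opprK linearZ /= -M0_mulmxE Mx0 mxE.
  by rewrite scaler0.
Qed.

(** Source of the summand spanned by Z_(d+1): the only entry is l of [Z_(d+1), Z_(d+1)], which
    vanishes, so every column is in the kernel. *)
Lemma nullspace_in_M0_1 l d : nullspace_in Z d (M0 Z l d 1) = <[Z`_d]>%VS.
Proof.
apply/vspaceP => Y; apply/nullspace_inP/vlineP => [[x _ ->]|[k ->]].
  by exists (x 0 0); rewrite /embed_col big_ord1 addn0.
exists (const_mx k); last by rewrite /embed_col big_ord1 addn0 mxE.
apply/matrixP => a b.
by rewrite !mxE big_ord1 !mxE !ord1 lie_alternating linear0 mul0r.
Qed.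

Lemma nullspace_in_full_rank d s (M : 'M[F]_s) :
  \rank M = s -> nullspace_in Z d M = 0%VS.
Proof.
move=> rM; apply/eqP; rewrite -subv0; apply/subvP => _ /nullspace_inP[x Mx0 ->].
have uM : M \in unitmx by rewrite -row_free_unit /row_free rM.
by rewrite -(mulKmx uM x) Mx0 mulmx0 linear0 mem0v.
Qed.

Lemma radical_sub_vergne l j : (1 <= j <= n)%N ->
  (radical l (malcev_span Z j) <= vergne_polarization Z l)%VS.
Proof.
move=> jn; rewrite /vergne_polarization.
by rewrite (big_rem j) /= ?addvSl // mem_index_iota ltnS.
Qed.

End Radical.

Theorem theorem5 (R : realType) (g : lieAlgType R) (n d : nat)
    (Z : n.-tuple g) (l : 'Hom(g, R^o))
    (g_nilpotent : lie_nilpotent g)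
    (dim_g : \dim {:g} = n)
    (dim_center : \dim (lie_center g) = d)
    (Z_malcev : strong_malcev_basis_through_center Z) :
  vergne_polarization Z l =
    (lie_center g + <[Z`_d]>
     + \sum_(2 <= s < (n - d).+1 | s \notin Iset Z l d)
         nullspace_in Z d (M0 Z l d s))%VS.
Proof.
have spand : malcev_span Z d = lie_center g.
  by rewrite -dim_center; case: Z_malcev.
have rad s := radical_malcev_span l s spand.
have dn : (d <= n)%N by rewrite -dim_center -dim_g dimvS ?subvf.
apply/eqP; rewrite eqEsubv; apply/andP; split.
  rewrite /vergne_polarization big_seq_cond.
  elim/big_ind: _ => [|U V sU sV|j]; rewrite ?sub0v ?subv_add ?sU //.
  rewrite andbT mem_index_iota ltnS => /andP[j0 jn].
  (* For j <= d the radical sits in g_j, which is contained in g_d, the center. Otherwise j = d + s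
     with s > 0. *)
  have [jd|dj] := leqP j d.
    apply: subv_trans (capvSl _ _) _; apply: subv_trans (malcev_spanS Z jd) _.
    by rewrite spand -addvA addvSl.
  rewrite -(subnKC (ltnW dj)) rad; set s := (j - d)%N.
  have s0 : (0 < s)%N by rewrite subn_gt0.
  have sn : (s <= n - d)%N by rewrite leq_sub2r.
  rewrite subv_add -{1}addvA addvSl /=.
  have [s1|s1] := leqP s 1.
    have -> : s = 1%N by apply/eqP; rewrite eqn_leq s1.
    by rewrite nullspace_in_M0_1 (subv_trans (addvSr _ _) (addvSl _ _)).
  have [|sI] := boolP (s \in Iset Z l d).
    rewrite inE => /andP[_ /eqP rM].
    by rewrite nullspace_in_full_rank ?sub0v.
  apply: subv_trans (addvSr _ _); rewrite -big_filter (big_rem s) ?addvSl //.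
  by rewrite mem_filter sI mem_index_iota s1 ltnS.
(* The Vergne sum starts at j = 1, hence the positivity condition. *)
have subrad s : (d + s <= n)%N -> (0 < d + s)%N ->
    (lie_center g + nullspace_in Z d (M0 Z l d s) <= vergne_polarization Z l)%VS.
  by move=> sn s0; rewrite -rad radical_sub_vergne // s0.
rewrite !subv_add -andbA; apply/and3P; split.
(* If d > 0, the center is reached through the radical at j = d, that is s = 0. If d = 0 there is no
   such term, but the center is zero. *)
- have [d0|d0] := posnP d.
    move: dim_center; rewrite d0 => /eqP; rewrite dimv_eq0 => /eqP ->.
    exact: sub0v.
  by apply: subv_trans (subrad 0 _ _); rewrite ?addvSl ?addn0.
(* When n <= d the index is out of range and the vector is the default 0. Otherwise it comes from
   the radical at j = d + 1. *)
- have [nd|nd] := leqP n d.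
    by rewrite nth_default ?size_tuple // -memvE mem0v.
  rewrite -(nullspace_in_M0_1 Z l d).
  by apply: subv_trans (subrad 1%N _ _); rewrite ?addvSr ?addn1.
- rewrite big_seq_cond; elim/big_ind: _ => [|U V sU sV|s].
  + exact: sub0v.
  + by rewrite subv_add sU.
  rewrite mem_index_iota ltnS => /andP[/andP[s2 sn] _].
  apply: subv_trans (subrad s _ _); rewrite ?addvSr //.
    by rewrite -(subnKC dn) leq_add2l.
  by rewrite addn_gt0 (ltnW s2) orbT.
Qed.
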